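(* Let $\mathbb{X}$ be a linearly ordered radicable idempotent commutative semifield and let $n\geq1$. For any matrices $A,B\in\mathbb{X}^{n\times n}$ and any integer $m\geq1$, $$ \mathrm{tr}(A\oplus B)^{m}=\mathrm{tr}B^{m}\oplus\bigoplus_{k=1}^{m}\ \bigoplus_{i_{1}+\cdots+i_{k}=m-k}\mathrm{tr}(AB^{i_{1}}\cdots AB^{i_{k}}), $$ where $\mathrm{tr}(A\oplus B)^{m}$ denotes the trace of the matrix $(A\oplus B)^{m}$ and the inner sum is over all $k$-tuples of nonnegative integers $i_{1},\ldots,i_{k}$ with $i_{1}+\cdots+i_{k}=m-k$.
   Context: An idempotent commutative semifield $\langle\mathbb{X},\mathbb{0},\mathbb{1},\oplus,\otimes\rangle$ is a set with associative and commutative operations $\oplus$ (neutral element $\mathbb{0}$) and $\otimes$ (neutral element $\mathbb{1}$, sign omitted), where multiplication distributes over addition, $\mathbb{0}$ is absorbing for multiplication, $x\oplus x=x$ for all $x$, and every $x\neq\mathbb{0}$ has a multiplicative inverse (with $\mathbb{1}\neq\mathbb{0}$). The order is $x\leq y\iff x\oplus y=y$; linearly ordered means this order is total. Radicable means that rational powers are defined: for every $x\in\mathbb{X}$ and integer $p\geq1$ there is $x^{1/p}\in\mathbb{X}$ with $(x^{1/p})^{p}=x$. Matrix operations are $\{A\oplus B\}_{ij}=a_{ij}\oplus b_{ij}$ and $\{AB\}_{ij}=\bigoplus_{k=1}^{n}a_{ik}b_{kj}$; $I$ is the identity matrix ($\mathbb{1}$ on the diagonal, $\mathbb{0}$ elsewhere),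 and $A^{0}=I$, $A^{p}=A^{p-1}A$ for $p\geq1$. The trace is $\mathrm{tr}A=a_{11}\oplus\cdots\oplus a_{nn}$. *)

(* Defs.v *)
From HB Require Import structures.
From mathcomp Require Import all_boot all_order all_algebra.

Set Implicit Arguments.
Unset Strict Implicit.
Unset Printing Implicit Defensive.

Import GRing.Theory.
Local Open Scope ring_scope.

(* The order x <= y of an idempotent semiring, i.e. x (+) y = y. *)
Definition idem_le (X : nmodType) (x y : X) : Prop := x + y = y.

(* A [comNzSemiRingType] supplies the commutative semiring axioms, the
   absorbing zero and 1 != 0; ring addition and multiplication are the
   semifield operations (+) and (x).  Matrix sums, products, powers and traces
   over X are therefore MathComp's generic semiring ones. *)
Record idempotent_semifield (X : comNzSemiRingType) : Prop :=
  IdempotentSemifield {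
    semifield_addxx : forall x : X, x + x = x;
    semifield_inv : forall x : X, x != 0 -> exists y : X, x * y = 1
  }.

Definition linearly_ordered (X : nmodType) : Prop :=
  forall x y : X, idem_le x y \/ idem_le y x.

Definition radicable (X : pzSemiRingType) : Prop :=
  forall (x : X) (p : nat), (1 <= p)%N -> exists y : X, y ^+ p = x.

(* Main.v *)
(** Expanding [(A + B)^m] gives the sum of all words of length [m] in [A] and
    [B].  A word containing [A] factors uniquely as [B^a (A B^i1) ... (A B^ik)];
    by cyclicity of the trace the leading [B^a] can be moved to the end, which
    turns it into a term of the right-hand side.  As addition is idempotent,
    multiplicities do not matter and it suffices to compare the terms of both
    sides in the order [x + y = y]. *)
Require Import Defs.
From HB Require Import structures.
From mathcomp Require Import all_boot all_order all_algebra.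

Set Implicit Arguments.
Unset Strict Implicit.
Unset Printing Implicit Defensive.

Import GRing.Theory.
Local Open Scope ring_scope.

Lemma idem_le_anti (X : nmodType) (x y : X) :
  idem_le x y -> idem_le y x -> x = y.
Proof. by rewrite /idem_le => xy yx; rewrite -yx addrC. Qed.

Lemma idem_le_trans (X : nmodType) (y x z : X) :
  idem_le x y -> idem_le y z -> idem_le x z.
Proof. by rewrite /idem_le => xy yz; rewrite -yz addrA xy. Qed.

Lemma idem_le_add (X : nmodType) (x y z : X) :
  idem_le x z -> idem_le y z -> idem_le (x + y) z.
Proof. by rewrite /idem_le => xz yz; rewrite -addrA yz. Qed.

Lemma idem_le_sum (X : nmodType) (I : Type) (r : seq I) (P : pred I)
    (F : I -> X) (z : X) :
  (forall i, P i -> idem_le (F i) z) -> idem_le (\sum_(i <- r | P i) F i) z.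
Proof.
move=> Fz; elim/big_rec: _ => [|i x Pi xz]; first exact: add0r.
exact: idem_le_add (Fz i Pi) xz.
Qed.

Lemma idem_le_addl (X : nmodType) (x y : X) :
  (forall z : X, z + z = z) -> idem_le x (x + y).
Proof. by move=> addxx; rewrite /idem_le addrA addxx. Qed.

Lemma idem_le_addr (X : nmodType) (x y : X) :
  (forall z : X, z + z = z) -> idem_le y (x + y).
Proof. by move=> addxx; rewrite addrC; apply: idem_le_addl. Qed.

Lemma idem_le_term (X : nmodType) (I : eqType) (r : seq I) (P : pred I)
    (F : I -> X) (i : I) :
  (forall z : X, z + z = z) -> i \in r -> P i ->
  idem_le (F i) (\sum_(j <- r | P j) F j).
Proof.
by move=> addxx ir Pi; rewrite (big_rem i ir) Pi; apply: idem_le_addl.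
Qed.

Lemma idem_le_mul (S : pzSemiRingType) (x y u v : S) :
  idem_le x y -> idem_le u v -> idem_le (x * u) (y * v).
Proof.
rewrite /idem_le => xy uv; apply: (@idem_le_trans _ (x * v)).
  by rewrite /idem_le -mulrDr uv.
by rewrite /idem_le -mulrDl xy.
Qed.

Lemma idem_le_expr (S : pzSemiRingType) (x y : S) (k : nat) :
  (forall z : S, z + z = z) -> idem_le x y -> idem_le (x ^+ k) (y ^+ k).
Proof.
move=> addxx xy; elim: k => [|k IHk]; first by rewrite !expr0; apply: addxx.
by rewrite !exprS; apply: idem_le_mul.
Qed.

(** By monotonicity of multiplication: [a] and [b] both lie below [a + b], so a block [a * b ^+ i]
    lies below [(a + b) ^+ i.+1], and the exponents add up. *)
Lemma idem_le_blocks (S : pzSemiRingType) (a b : S) (s : seq nat) :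
  (forall z : S, z + z = z) ->
  idem_le (\prod_(i <- s) (a * b ^+ i)) ((a + b) ^+ (size s + sumn s)).
Proof.
move=> addxx; elim: s => [|i s IHs]; first by rewrite big_nil; apply: addxx.
rewrite big_cons /= addSn addnCA -addSn exprD exprS.
apply: idem_le_mul => //; apply: idem_le_mul.
  exact: idem_le_addl.
by apply: idem_le_expr => //; apply: idem_le_addr.
Qed.

(* The prefix [p] collects the letters already read; each word is reached in
   the form [b^l (a b^s1) ... (a b^sk)]. *)
Lemma expr_add_idem_le (S : pzSemiRingType) (X : nmodType)
    (f : {additive S -> X}) (a b : S) (z : X) (m : nat) (p : S) :
  (forall (l : nat) (s : seq nat), (l + (size s + sumn s))%N = m ->
     idem_le (f (p * (b ^+ l * \prod_(i <- s) (a * b ^+ i)))) z) ->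
  idem_le (f (p * (a + b) ^+ m)) z.
Proof.
elim: m p => [|m IHm] p words_le.
  by have := words_le 0 [::] erefl; rewrite big_nil mulr1.
rewrite exprS mulrA mulrDr mulrDl raddfD.
apply: idem_le_add; apply: IHm => l s lsm.
  (* Reading [a] turns the leading power [b ^+ l] into a new first block, leaving an empty leading
     power. *)
  have := words_le 0 (l :: s); rewrite big_cons expr0 mul1r !mulrA; apply.
  by rewrite /= -lsm add0n addSn addnCA.
(* Reading [b] only lengthens the leading power. *)
have := words_le l.+1 s; rewrite exprS !mulrA; apply.
by rewrite addSn lsm.
Qed.

Lemma leq_nth_sumn (s : seq nat) (j : nat) : (nth 0 s j <= sumn s)%N.
Proof.
elim: s j => [|i s IHs] [|j] //=; first exact: leq_addr.
exact: leq_trans (IHs j) (leq_addl _ _).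
Qed.

Theorem lemma1 (X : comNzSemiRingType)
    (X_semifield : idempotent_semifield X)
    (X_linear : linearly_ordered X)
    (X_radicable : radicable X)
    (n : nat) (n_ge1 : (1 <= n)%N) (A B : 'M[X]_n)
    (m : nat) (m_ge1 : (1 <= m)%N) :
  \tr ((A + B) ^+ m) =
    \tr (B ^+ m) +
    \sum_(1 <= k < m.+1)
      \sum_(i : {ffun 'I_k -> 'I_(m - k).+1} | (\sum_(j < k) i j == m - k)%N)
        \tr (\prod_(j < k) (A * B ^+ i j)).
Proof.
have addxx := semifield_addxx X_semifield.
have addMM (M : 'M[X]_n) : M + M = M by apply/matrixP=> i j; rewrite mxE addxx.
have tr_le (M N : 'M[X]_n) : idem_le M N -> idem_le (\tr M) (\tr N).
  by rewrite /idem_le -mxtraceD => ->.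
apply: idem_le_anti; last first.
  apply: idem_le_add.
    by apply: tr_le; apply: (idem_le_expr _ addMM);
      apply: (idem_le_addr _ _ addMM).
  rewrite big_nat; apply: idem_le_sum => k /andP[k_gt0 k_le].
  apply: idem_le_sum => i /eqP sum_i; apply: tr_le.
  (* As a list, the exponents give a word of length k + (m - k) = m. *)
  pose s := [seq nat_of_ord (i j) | j <- index_enum 'I_k].
  have size_s : size s = k.
    by rewrite -sum1_size big_map sum1_card card_ord.
  have sumn_s : sumn s = (m - k)%N by rewrite sumnE big_map.
  have := idem_le_blocks A B s addMM.
  by rewrite big_map size_s sumn_s subnKC.
rewrite -[(A + B) ^+ m]mul1r.
apply: (@expr_add_idem_le _ _ (@mxtrace X n)) => l s.
(* A word without blocks is [B ^+ m]; otherwise the last block is exposed, as it will absorb the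
   leading [B ^+ l]. *)
case/lastP: s => [|s x] lsm.
  by rewrite big_nil mulr1 mul1r -lsm addn0; apply: idem_le_addl.
apply: idem_le_trans (idem_le_addr _ _ addxx).
(* Cyclicity of the trace carries [B ^+ l] to the end, where [A * B ^+ x] becomes
   [A * B ^+ (x + l)]. *)
rewrite mul1r /=; set t := rcons s (x + l)%N.
have -> : \tr (B ^+ l * \prod_(i <- rcons s x) (A * B ^+ i))
    = \tr (\prod_(i <- t) (A * B ^+ i)).
  rewrite /t -!cats1 !big_cat !big_seq1 exprD /=.
  by rewrite [LHS]mxtrace_mulC !mulmxE !mulrA.
have tm : (size t + sumn t)%N = m.
  rewrite -lsm /t !size_rcons -!cats1 !sumn_cat /= !addn0.
  by rewrite [RHS]addnC !addnA.
have t_le : (size t <= m)%N by rewrite -tm leq_addr.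
have sumn_t : sumn t = (m - size t)%N by rewrite -tm addKn.
pose k := size t.
(* [inord] never truncates here: each entry of [t] is at most [sumn t], which is m - k. *)
pose i : {ffun 'I_k -> 'I_(m - k).+1} := [ffun j : 'I_k => inord (nth 0 t j)].
have iE (j : 'I_k) : i j = nth 0 t j :> nat.
  by rewrite ffunE inordK // ltnS /k -sumn_t leq_nth_sumn.
(* The trace is located in two stages: as the term [i] of the inner sum [F k], then [F k] as a term
   of the outer sum. *)
pose F k := \sum_(i : {ffun 'I_k -> 'I_(m - k).+1} |
  (\sum_(j < k) i j == m - k)%N) \tr (\prod_(j < k) (A * B ^+ i j)).
apply: (@idem_le_trans _ (F k)); last first.
  apply: (idem_le_term (P := xpredT) F) => //.
  by rewrite mem_index_iota ltnS t_le andbT /k /t size_rcons.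
have -> : \prod_(x <- t) (A * B ^+ x) = \prod_(j < k) (A * B ^+ i j).
  by rewrite (big_nth 0%N) big_mkord; apply: eq_bigr => j _; rewrite iE.
apply: (idem_le_term (fun i : {ffun 'I_k -> 'I_(m - k).+1} =>
  \tr (\prod_(j < k) (A * B ^+ i j)))) => //; first exact: mem_index_enum.
apply/eqP; transitivity (sumn t); last exact: sumn_t.
rewrite sumnE (big_nth 0%N) big_mkord.
by apply: eq_bigr => j _; rewrite iE.
Qed.
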